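(* In the extension of $\mathcal{L}_\nu$ by second-order quantification over the set variable, with $[\![\forall X\varphi]\!]_E=\{\omega\in\Omega:\forall F\subseteq\Omega,\ \omega\in[\![\varphi]\!]_F\}$, for every player $i$ and every positive optimality condition $\phi_i$ the formula $\mathit{rat}_{\phi_i}\leftrightarrow\forall X(\Box_iX\rightarrow O_{\phi_i}X)$ is valid, i.e. in every belief model $[\![\mathit{rat}_{\phi_i}]\!]=[\![\forall X(\Box_iX\to O_{\phi_i}X)]\!]$.
   Context: Strategic game $G=(T_1,\dots,T_n,<_1,\dots,<_n)$, $\ge_i$ reflexive closure of $<_i$. Optimality condition for $i$: closed first-order formula over atoms $C(a)$, $a\ge^i_cb$, constant $o$, interpreted in $(G,G',s)$ ($G'$ restriction, $s\in T$, $o\mapsto s$) by $C(x)$ iff $\alpha(x)_j\in G'_j\ \forall j$ and $x\ge^i_zy$ iff $(\alpha(x)_i,\alpha(z)_{-i})\ge_i(\alpha(y)_i,\alpha(z)_{-i})$; positive if every $C(\cdot)$ lies under an even number of negations. Belief model $(\Omega,\bar s_1,\dots,\bar s_n,P_1,\dots,P_n)$, $(G_E)_i=\{\bar s_i(u):u\in E\}$. Semantics: $[\![\mathit{rat}_{\phi_i}]\!]_E=\{\omega:(G,G_{P_i(\omega)},\bar s(\omega))\models\phi_i\}$, $[\![X]\!]_E=E$, $[\![\Box_i\psi]\!]_E=\{\omega:P_i(\omega)\subseteq[\![\psi]\!]_E\}$, $[\![O_{\phi_i}\psi]\!]_E=\{\omega:(G,G_{[\![\psi]\!]_E},\bar s(\omega))\models\phi_i\}$,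 $\to$ and $\leftrightarrow$ interpreted classically. *)

(* Defs.v *)
From mathcomp Require Import all_boot.
Unset Printing Implicit Defensive.

(* G = (T_1,...,T_n, <_1,...,<_n): strategy sets T_j and, for each player i,
   a (strict) preference relation <_i on strategy profiles. *)
Record game (n : nat) := Game {
  strat : 'I_n -> Type;
  lt_pref : 'I_n -> (forall j : 'I_n, strat j) -> (forall j : 'I_n, strat j) -> Prop
}.

Arguments strat {n} g j.
Arguments lt_pref {n} g i _ _.

Definition profile n (G : game n) := forall j : 'I_n, strat G j.

Arguments profile {n} G.

Definition ge_pref n (G : game n) (i : 'I_n) (a b : profile G) : Prop :=
  lt_pref G i b a \/ a = b.

Arguments ge_pref {n G} i a b.

Definition upd n (G : game n) (i : 'I_n) (x z : profile G) : profile G :=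
  fun j => if j == i then x j else z j.

Arguments upd {n G} i x z j.

Definition restriction n (G : game n) := forall j : 'I_n, strat G j -> Prop.

Arguments restriction {n} G.

Inductive oterm := OVar of nat | OConst.

Inductive oform :=
| OC of oterm
| OGe of oterm & oterm & oterm      (* OGe a c b  is  a >=^i_c b *)
| ONot of oform
| OAnd of oform & oform
| OAll of nat & oform.

Definition OOr a b := ONot (OAnd (ONot a) (ONot b)).
Definition OImp a b := ONot (OAnd a (ONot b)).
Definition OEx v a := ONot (OAll v (ONot a)).

Definition tfree (t : oterm) (v : nat) : bool :=
  if t is OVar w then w == v else false.

Fixpoint ofree (v : nat) (phi : oform) : bool :=
  match phi with
  | OC a => tfree a v
  | OGe a c b => [|| tfree a v, tfree c v | tfree b v]
  | ONot p => ofree v p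
  | OAnd p q => ofree v p || ofree v q
  | OAll w p => (w != v) && ofree v p
  end.

Definition oclosed (phi : oform) : Prop := forall v, ofree v phi = false.

(* positivity: every occurrence of C lies under an even number of negations.
   opol p phi : every C-occurrence in phi has polarity p (true = even). *)
Fixpoint opol (p : bool) (phi : oform) : bool :=
  match phi with
  | OC _ => p
  | OGe _ _ _ => true
  | ONot q => opol (~~ p) q
  | OAnd q r => opol p q && opol p r
  | OAll _ q => opol p q
  end.

Definition opositive (phi : oform) : bool := opol true phi.

Section OSem.
Variables (n : nat) (G : game n) (i : 'I_n) (G' : restriction G) (s : profile G).

Definition tval (alpha : nat -> profile G) (t : oterm) : profile G :=
  match t with OVar v => alpha v | OConst => s end.

Definition oupd (alpha : nat -> profile G) (v : nat) (d : profile G) :=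
  fun w => if w == v then d else alpha w.

Fixpoint osat (alpha : nat -> profile G) (phi : oform) : Prop :=
  match phi with
  | OC a => forall j : 'I_n, G' j (tval alpha a j)
  | OGe a c b =>
      ge_pref i (upd i (tval alpha a) (tval alpha c))
                (upd i (tval alpha b) (tval alpha c))
  | ONot q => ~ osat alpha q
  | OAnd q r => osat alpha q /\ osat alpha r
  | OAll v q => forall d : profile G, osat (oupd alpha v d) q
  end.

(* (G, G', s) |= phi  (phi closed, so the assignment is irrelevant) *)
Definition omodels (phi : oform) : Prop := forall alpha, osat alpha phi.
End OSem.

Arguments tval {n G} s alpha t.
Arguments oupd {n G} alpha v d w.
Arguments osat {n G} i G' s alpha phi.
Arguments omodels {n G} i G' s phi.

Record belief_model n (G : game n) := BM {
  Omega : Type;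
  sbar : forall j : 'I_n, Omega -> strat G j;
  Poss : 'I_n -> Omega -> Omega -> Prop
}.

Arguments Omega {n G} b.
Arguments sbar {n G} b j _.
Arguments Poss {n G} b i _ _.

Definition sprof n (G : game n) (M : belief_model n G) (w : Omega M) : profile G :=
  fun j => sbar M j w.

Arguments sprof {n G} M w j.

Definition GE n (G : game n) (M : belief_model n G) (E : Omega M -> Prop)
  : restriction G :=
  fun j t => exists u, E u /\ sbar M j u = t.

Arguments GE {n G} M E j t.

Inductive lform n :=
| LRat of 'I_n & oform
| LX
| LBox of 'I_n & lform n
| LO of 'I_n & oform & lform n
| LImp of lform n & lform n
| LIff of lform n & lform n
| LAllX of lform n.

Arguments LX {n}.
Arguments LRat {n} _ _.
Arguments LBox {n} _ _.
Arguments LO {n} _ _ _.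
Arguments LImp {n} _ _.
Arguments LIff {n} _ _.
Arguments LAllX {n} _.

Fixpoint lsem n (G : game n) (M : belief_model n G) (E : Omega M -> Prop)
  (psi : lform n) : Omega M -> Prop :=
  match psi with
  | LRat i phi => fun w => omodels i (GE M (Poss M i w)) (sprof M w) phi
  | LX => E
  | LBox i p => fun w => forall u, Poss M i w u -> lsem n G M E p u
  | LO i phi p => fun w => omodels i (GE M (lsem n G M E p)) (sprof M w) phi
  | LImp p q => fun w => lsem n G M E p w -> lsem n G M E q w
  | LIff p q => fun w => lsem n G M E p w <-> lsem n G M E q w
  | LAllX p => fun w => forall F : Omega M -> Prop, lsem n G M F p w
  end.

Arguments lsem {n G} M E psi w.

(* Main.v *)
Require Import Defs.
From mathcomp Require Import all_boot.

(* Positive optimality conditions are monotone in the restriction, and G_E is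
   monotone in E.  So if phi_i holds relative to G_{P_i(w)}, it holds relative
   to G_F for every F containing P_i(w); conversely, taking F := P_i(w) makes
   O_{phi_i} F collapse to rat_{phi_i}. *)

Definition subrestriction n (G : game n) (G1 G2 : restriction G) : Prop :=
  forall j t, G1 j t -> G2 j t.

Arguments subrestriction {n G} G1 G2.

Section Monotonicity.
Context {n : nat} {G : game n} {i : 'I_n} {G1 G2 : restriction G} {s : profile G}.
Hypothesis G1_sub_G2 : subrestriction G1 G2.

Lemma osat_opol_mono (phi : oform) (p : bool) (alpha : nat -> profile G) :
  opol p phi ->
  if p then osat i G1 s alpha phi -> osat i G2 s alpha phi
  else osat i G2 s alpha phi -> osat i G1 s alpha phi.
Proof.
elim: phi p alpha => [a|a c b|q IHq|q IHq r IHr|v q IHq] p alpha /=.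
- by move=> -> Ca j; apply: G1_sub_G2.
- by case: p.
- by move/(IHq _ alpha); case: p => /= mono notq /mono.
- case/andP=> /(IHq _ alpha) monoq /(IHr _ alpha) monor.
  by case: p monoq monor => monoq monor [/monoq ? /monor ?].
- move=> pol_q; case: p pol_q => pol_q sat_q d.
  + exact: (IHq true (oupd alpha v d) pol_q (sat_q d)).
  + exact: (IHq false (oupd alpha v d) pol_q (sat_q d)).
Qed.

Lemma omodels_positive_mono {phi : oform} :
  opositive phi -> omodels i G1 s phi -> omodels i G2 s phi.
Proof. by move=> pos_phi sat1 alpha; exact: osat_opol_mono pos_phi (sat1 alpha). Qed.

End Monotonicity.

Lemma GE_subrestriction {n} {G : game n} {M : belief_model n G} {E F : Omega M -> Prop} :
  (forall u, E u -> F u) -> subrestriction (GE M E) (GE M F).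
Proof. by move=> EF j t [u [Eu <-]]; exists u; split; first exact: EF. Qed.

Theorem mainTheorem13 (n : nat) (G : game n) (i : 'I_n) (phi : oform) :
  oclosed phi -> opositive phi ->
  forall (M : belief_model n G) (E : Omega M -> Prop) (w : Omega M),
    lsem M E (LIff (LRat i phi) (LAllX (LImp (LBox i LX) (LO i phi LX)))) w.
Proof.
move=> _ pos_phi M E w /=; split.
- move=> rat_w F box_F.
  exact (omodels_positive_mono (GE_subrestriction box_F) pos_phi rat_w).
- by move=> O_all; apply: (O_all (Poss M i w)).
Qed.
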